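(* Let $(V,\top)$ be a locality vector space. If a linear subspace $W$ of $V$ admits a strong locality complement, then $W$ is locality compatible with $\top$.
   Context: The ground field is $\mathbb{R}$ or $\mathbb{C}$. A locality vector space is a vector space $V$ with a symmetric relation $\top\subset V\times V$ containing $(0,0)$ such that for every subset $U\subset V$ the polar set $U^\top=\{x\in V: x\top u\ \forall u\in U\}$ is a linear subspace. For maps $\varphi,\psi:V\to V$, $\varphi\top\psi$ means: $x\top y$ implies $\varphi(x)\top\psi(y)$. A strong locality complement of a subspace $W$ is a subspace $\widetilde W$ with $W\oplus\widetilde W=V$ such that, with $\pi$ (resp. $\widetilde\pi$) the projection onto $W$ along $\widetilde W$ (resp. onto $\widetilde W$ along $W$), one of the following equivalent properties holds: (1) $\pi\top\pi$ and $\pi\top\widetilde\pi$; (2) $\pi\top{\rm Id}_V$; (3) $\widetilde\pi\top\widetilde\pi$ and $\pi\top\widetilde\pi$; (4) $\widetilde\pi\top{\rm Id}_V$. A subspace $W$ is locality compatible with $\top$ if for all $(x,y,z)\in V^3$ and $w\in W$ with $x\top y$ and $(x+w)\top z$, there exists $w'\in W$ with $(x+w')\top y$ and $(x+w')\top z$. *)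

(* Defs.v *)
From mathcomp Require Import all_boot all_order all_algebra.
From mathcomp Require Import boolp classical_sets reals complex.

Set Implicit Arguments.
Unset Strict Implicit.
Unset Printing Implicit Defensive.

Import GRing.Theory.

Local Open Scope ring_scope.
Local Open Scope classical_set_scope.

Variant ground := GroundReal | GroundComplex.

(* The ground field is the field of reals or the field of complexes; every
   [R : realType] is a model of the real numbers. *)
Definition ground_field (R : realType) (k : ground) : fieldType :=
  match k with
  | GroundReal => R
  | GroundComplex => R[i]
  end.

Section Locality.

Variables (K : fieldType) (V : lmodType K).
Implicit Types (top : V -> V -> Prop) (U W : set V) (p q : V -> V).

Definition is_subspace W : Prop := submod_closed (mem W).

Definition polar top U : set V := [set x | forall u, U u -> top x u].

Definition locality_space top : Prop :=
  [/\ forall x y, top x y -> top y x,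
      top 0 0 &
      forall U, is_subspace (polar top U)].

Definition locality_maps top p q : Prop :=
  forall x y, top x y -> top (p x) (q y).

Definition direct_sum W (W' : set V) : Prop :=
  W `&` W' = [set 0] /\ [set w + w' | w in W & w' in W'] = [set: V].

(* Meaningful when [direct_sum W W'] holds: [proj W W' x] is then the unique
   [w] in [W] such that [x - w] is in [W']; the default value 0 is not used. *)
Definition proj W (W' : set V) (x : V) : V := xget 0 [set w | W w /\ W' (x - w)].

(* The four alternatives are equivalent for a locality vector space. *)
Definition strong_locality_complement top W (W' : set V) : Prop :=
  let p := proj W W' in
  let p' := proj W' W in
  [/\ is_subspace W', direct_sum W W' &
      [\/ locality_maps top p p /\ locality_maps top p p',
          locality_maps top p id,
          locality_maps top p' p' /\ locality_maps top p p' |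
          locality_maps top p' id]].

Definition locality_compatible top W : Prop :=
  forall x y z w, W w -> top x y -> top (x + w) z ->
    exists2 w', W w' & top (x + w') y /\ top (x + w') z.

End Locality.

(* Main.v *)
Require Import Defs.
From mathcomp Require Import all_boot all_order all_algebra.
From mathcomp Require Import boolp classical_sets reals complex.

(** Let [p] and [p'] be the projections onto [W] and onto its complement [W'].
    The witness is [w' = - p x], so that [x + w' = p' x]. Since [p'] kills [W],
    also [x + w' = p' (x + w)]. Hence both required relations come from the
    single property [p' T Id] ([locality_proj_complement]), applied to [x T y]
    and to [(x + w) T z]. Each of the other forms of a strong complement implies
    it, because polar sets are subspaces: a relation with [p y] and with [p' y]
    gives one with their sum [y], and [p' x = x - p x]. *)

Import GRing.Theory.

Local Open Scope ring_scope.
Local Open Scope classical_set_scope.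

Section Projections.

Context {K : fieldType} {V : lmodType K}.
Implicit Types (W U : set V) (top : V -> V -> Prop).

Lemma subspaceB W (u v : V) : is_subspace W -> W u -> W v -> W (u - v).
Proof.
move=> [_ linW] /mem_set Wu /mem_set Wv.
by have /set_mem := linW (-1) v u Wv Wu; rewrite scaleN1r addrC.
Qed.

Lemma subspaceD W (u v : V) : is_subspace W -> W u -> W v -> W (u + v).
Proof.
move=> [_ linW] /mem_set Wu /mem_set Wv.
by have /set_mem := linW 1 u v Wu Wv; rewrite scale1r.
Qed.

Lemma subspace0 W : is_subspace W -> W 0.
Proof. by case=> /set_mem. Qed.

Lemma direct_sumC W W' : direct_sum W W' -> direct_sum W' W.
Proof.
move=> [capWW' sumWW']; split; first by rewrite setIC.
apply/seteqP; split=> // v _.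
have [w Ww [w' Ww' <-]] : [set w + w' | w in W & w' in W'] v by rewrite sumWW'.
by exists w' => //; exists w => //; rewrite addrC.
Qed.

Lemma proj_spec W W' (x : V) :
  direct_sum W W' -> W (proj W W' x) /\ W' (x - proj W W' x).
Proof.
move=> [_ sumWW'].
have [w Ww [w' Ww' <-]] : [set w + w' | w in W & w' in W'] x by rewrite sumWW'.
apply: (@xgetPex _ 0 [set u | W u /\ W' (w + w' - u)]); exists w; split=> //.
by rewrite addrAC subrr add0r.
Qed.

Lemma proj_unique W W' (x w : V) :
  is_subspace W -> is_subspace W' -> direct_sum W W' ->
  W w -> W' (x - w) -> proj W W' x = w.
Proof.
move=> subW subW' dWW' Ww Ww'; have [Wp Wp'] := proj_spec W W' x dWW'.
apply/eqP; rewrite -subr_eq0; apply/eqP.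
have [capWW' _] := dWW'.
have : (W `&` W') (proj W W' x - w).
  split; first exact: subspaceB.
  by have := subspaceB _ _ _ subW' Ww' Wp'; rewrite opprB addrC addrA subrK.
by rewrite capWW'.
Qed.

Lemma proj_complementE W W' (x : V) :
  is_subspace W -> is_subspace W' -> direct_sum W W' ->
  proj W' W x = x - proj W W' x.
Proof.
move=> subW subW' dWW'; have [Wp Wp'] := proj_spec W W' x dWW'.
by apply: proj_unique => //; [exact: direct_sumC | rewrite subKr].
Qed.

Lemma proj_complementDr W W' (x w : V) :
  is_subspace W -> is_subspace W' -> direct_sum W W' -> W w ->
  proj W' W (x + w) = proj W' W x.
Proof.
move=> subW subW' dWW' Ww.
have dW'W := direct_sumC _ _ dWW'; have [W'p Wp] := proj_spec W' W x dW'W.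
by apply: proj_unique => //; rewrite addrAC; apply: subspaceD.
Qed.

Lemma localityBl top (x u y : V) :
  locality_space top -> top x y -> top u y -> top (x - u) y.
Proof.
move=> [_ _ polarP] xy uy.
by apply: (subspaceB _ x u (polarP [set y])) => // _ ->.
Qed.

Lemma localityDr top (x y z : V) :
  locality_space top -> top x y -> top x z -> top x (y + z).
Proof.
move=> [symT _ polarP] xy xz; apply: (symT).
by apply: (subspaceD _ y z (polarP [set x])) => // _ ->; apply: (symT).
Qed.

(** Polar sets turn the pairs of relations in the first and third forms into
    one relation with the identity, and exchange [p] with [p' = Id - p]. In the
    third form the mixed relation is [p T p'], and symmetry of the locality
    relation is what lets it be read as [p' T p]. *)
Lemma locality_proj_complement top W W' :
  locality_space top -> is_subspace W -> strong_locality_complement top W W' ->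
  locality_maps top (proj W' W) id.
Proof.
move=> locT subW [subW' dWW' strong]; have [symT _ _] := locT.
have projDE y : y = proj W W' y + proj W' W y.
  by rewrite (proj_complementE W W') // addrC subrK.
have from_proj : locality_maps top (proj W W') id ->
    locality_maps top (proj W' W) id.
  move=> pT x y xy; rewrite (proj_complementE W W') //.
  by apply: localityBl => //; apply: pT.
case: strong => [[pp pp']|/from_proj //|[p'p' pp']|//].
- apply: from_proj => x y xy; rewrite /= (projDE y).
  by apply: localityDr => //; [apply: pp | apply: pp'].
- move=> x y xy; rewrite /= [X in top _ X]projDE.
  apply: localityDr => //; last exact: p'p'.
  by apply/symT/pp'/symT.
Qed.

End Projections.

Theorem proposition6p9 (R : realType) (k : ground)
    (V : lmodType (ground_field R k)) (top : V -> V -> Prop)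
    (htop : locality_space top) (W : set V) (hW : is_subspace W)
    (hcompl : exists W' : set V, strong_locality_complement top W W') :
  locality_compatible top W.
Proof.
case: hcompl => W' strong; have [subW' dWW' _] := strong.
have p'T := locality_proj_complement _ _ _ htop hW strong.
move=> x y z w Ww xy xwz.
have [Wp _] := proj_spec W W' x dWW'.
exists (- proj W W' x).
  by rewrite -sub0r; apply: subspaceB => //; apply: subspace0.
rewrite -proj_complementE //; split; first exact: p'T.
by rewrite -(proj_complementDr W W' x w) //; apply: p'T.
Qed.
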